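(* Let $A=\{a_1,a_2,\ldots\}\subset(0,\infty)$ be such that $a_{n+1}-a_n\ge 1$ for every $n\in\mathbb{N}$ and $$\lim_{n\to\infty}\frac{\log a_n}{n}=0.$$ Then there exists a Lebesgue measurable set $E\subset\mathbb{R}$ such that $$\lim_{t\to\infty}\lambda(E\cap[t,t+1])=1,$$ but $E$ does not contain any similar copy of $A$.
   Context: $\lambda$ denotes Lebesgue measure on $\mathbb{R}$. A similar copy of a set $S\subset\mathbb{R}$ is a set of the form $aS+b=\{ax+b: x\in S\}$ with $a,b\in\mathbb{R}$ and $a\neq 0$. *)

(* Defs.v *)
From HB Require Import structures.
From mathcomp Require Import all_boot all_order all_algebra.
From mathcomp Require Import all_classical all_reals all_analysis.

Set Implicit Arguments.
Unset Strict Implicit.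
Unset Printing Implicit Defensive.
Import Order.TTheory GRing.Theory Num.Theory.
Import numFieldNormedType.Exports.

Local Open Scope classical_set_scope.
Local Open Scope ring_scope.

(* The canonical sigma-algebra on R is the Borel one; Lebesgue measurability is
   membership in the Caratheodory sigma-algebra of the outer measure generated
   by interval length, i.e. the domain of [completed_lebesgue_measure]. *)
Definition lebesgue_measurable (R : realType) (E : set R) : Prop :=
  ((@wlength R idfun)^*)%mu.-cara.-measurable E.

Definition similar_copy (R : realType) (S T : set R) : Prop :=
  exists c d : R, c != 0 /\ T = [set c * x + d | x in S].

(* Main.v *)
Require Import Defs.
From HB Require Import structures.
From mathcomp Require Import all_boot all_order all_algebra.
From mathcomp Require Import all_classical all_reals all_analysis.
From mathcomp Require Import lra ring zify.

Set Implicit Arguments.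
Unset Strict Implicit.
Unset Printing Implicit Defensive.
Import Order.TTheory GRing.Theory Num.Theory.
Import numFieldNormedType.Exports.

Local Open Scope classical_set_scope.
Local Open Scope ring_scope.

(** For a negative ratio the copies of [A] run off to -oo, so any [E] inside
    [[0, +oo[] avoids them; the work is to remove from the ray a set of holes,
    one interval [[s j, s j + w j]] per unit interval with [w j] tending to 0,
    that meets [c A + d] for every [c > 0] and every [d].

    The holes are built in stages. Stage [k] takes care of the compact set of
    parameters [1/k <= c <= k], [|d| <= k], using cells of relative width
    [1/q], and only a bounded block of unit intervals lying beyond the earlier
    blocks; the blocks are then put end to end, with [q] increasing
    ([hit_all_parameters]).

    A single stage ([hit_compact_parameters]) is a union bound. Choose
    independently and uniformly one of [q] cells in each unit interval. Take
    every [k]-th point of the sequence, [m] of them, so that their images under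
    [x |-> c x + d] lie in distinct unit intervals; for fixed [(c, d)] all of
    them avoid the chosen cells with probability [(1 - 1/q)^m]. Rounding
    [(c, d)] to a net of mesh [1/L], with [L] about [q] times the largest point
    used, moves these images by at most [1/q], which is absorbed by doubling the
    cells. The net has [O((1 + a_M)^2)] points, with [M = n0 + m k] the last
    index; as [ln a_n = o(n)], this is smaller than [(q / (q - 1))^m] for some
    [m] ([subexponential_lt_geometric]), hence some choice of cells serves the
    whole net. The probability is carried out as a count of functions in
    [exists_transversal]. *)

(** * Transversals by counting *)

(** Each of the [m] distinct arguments [g i] excludes one value, whereas the
    values at the other arguments are free. *)
Lemma card_ffun_avoid (I : finType) (m N : nat) (g : 'I_m -> I)
    (y : 'I_m -> 'I_N.+1) : injective g ->
  (#|[set f : {ffun I -> 'I_N.+1} | [forall i, f (g i) != y i]]%SET|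
     <= N ^ m * N.+1 ^ (#|I| - m))%N.
Proof.
move=> g_inj.
pose F (x : I) : pred 'I_N.+1 := [pred z | [forall i, (g i == x) ==> (z != y i)]].
have -> : #|[set f : {ffun I -> 'I_N.+1} | [forall i, f (g i) != y i]]%SET|
          = #|family F|.
  apply: eq_card => f; rewrite finset.in_set.
  apply/forallP/familyP => [fP x|fP i].
    by rewrite inE; apply/forallP => i; apply/implyP => /eqP <-; exact: fP.
  by have := fP (g i); rewrite inE => /forallP/(_ i); rewrite eqxx.
rewrite card_family foldrE big_map big_enum /=.
have cg : #|codom g| = m by rewrite card_codom // card_ord.
have F_le x : (#|F x| <= if x \in codom g then N else N.+1)%N.
  case: ifPn => [/codomP[i ->]|_]; last first.
    by apply: leq_trans (max_card _) _; rewrite card_ord.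
  suff : (#|F (g i)| <= #|predC1 (y i)|)%N by rewrite cardC1 card_ord.
  apply: subset_leq_card; apply/fintype.subsetP => z; rewrite !inE => /forallP/(_ i).
  by rewrite eqxx.
apply: leq_trans (leq_prod (fun x _ => F_le x)) _.
rewrite (bigID (fun x => x \in codom g)) /=.
rewrite (eq_bigr (fun=> N)); last by move=> x ->.
rewrite [X in (_ * X)%N](eq_bigr (fun=> N.+1)); last by move=> x /negbTE ->.
rewrite !prod_nat_const cg.
suff -> : #|[pred x | x \notin codom g]| = (#|I| - m)%N by [].
by rewrite -(cardC (mem (codom g))) cg addKn.
Qed.

(** The union bound: each [p] prescribes the values of [f] at [m] distinct
    places, and a proportion [(N / N.+1) ^ m] of all functions misses all of
    them. *)
Lemma exists_transversal (P : finType) (m N : nat) (J : P -> 'I_m -> nat)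
    (y : P -> 'I_m -> 'I_N.+1) :
  (forall p, injective (J p)) -> (#|P| * N ^ m < N.+1 ^ m)%N ->
  exists f : nat -> 'I_N.+1, forall p, exists i, f (J p i) = y p i.
Proof.
move=> J_inj lt_m.
(* Only finitely many places occur, so functions on ['I_X] can be counted. *)
pose X := (\max_p \max_i J p i).+1.
have J_lt p i : (J p i < X)%N.
  rewrite ltnS; apply: leq_trans (leq_bigmax p).
  exact: (leq_bigmax (F := J p) i).
pose J' p i := Ordinal (J_lt p i).
have J'_inj p : injective (J' p) by move=> i j [] /J_inj.
case: (pickP (mem [set: P]%SET)) => [p0 _|P0]; last first.
  by exists (fun=> ord0) => p; have := P0 p; rewrite !inE.
have le_m : (m <= X)%N.
  by have := leq_card _ (J'_inj p0); rewrite !card_ord.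
pose Bad p := [set f : {ffun 'I_X -> 'I_N.+1} | [forall i, f (J' p i) != y p i]]%SET.
have lt_bad : (#|(\bigcup_p Bad p)%SET| < #|{ffun 'I_X -> 'I_N.+1}|)%N.
  apply: (@leq_ltn_trans (\sum_p #|Bad p|)%N).
    elim/big_rec2: _ => [|p n A _ IH]; first by rewrite finset.cards0.
    apply: leq_trans (leq_card_setU _ _).1 _.
    by rewrite leq_add2l.
  have le_Bad : (\sum_p #|Bad p| <= \sum_(p : P) N ^ m * N.+1 ^ (X - m))%N.
    apply: leq_sum => p _.
    by have := card_ffun_avoid (y p) (@J'_inj p); rewrite card_ord.
  apply: leq_ltn_trans le_Bad _.
  rewrite sum_nat_const card_ffun !card_ord mulnA.
  by rewrite -[in ltnRHS](subnKC le_m) expnD ltn_pmul2r // expn_gt0.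
have [f fP] : exists f, f \notin (\bigcup_p Bad p)%SET.
  apply/existsP; rewrite -negb_forall; apply: contraL lt_bad => /forallP Hf.
  rewrite -leqNgt; apply: subset_leq_card; apply/fintype.subsetP => f _; exact: Hf.
exists (fun j => if insub j is Some j' then f j' else ord0) => p.
have : f \notin Bad p.
  by apply: contra fP => fp; apply/finset.bigcupP; exists p.
rewrite inE negb_forall => /existsP[i]; rewrite negbK => /eqP fi.
exists i; case: insubP => [j _ jE|]; last by rewrite J_lt.
by have -> : j = J' p i by apply: val_inj.
Qed.

(** * Growth of the net *)

(** The only place where [ln (a n) = o(n)] is used: [C (1 + a_n)^2] grows
    slower than any exponential in [n], and [n] is affine in [m]. *)
Lemma subexponential_lt_geometric (R : realType) (a : nat -> R) (C r : R)
    (n0 k : nat) :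
  (forall n, (1 <= n)%N -> 0 < a n) ->
  (fun n : nat => ln (a n) / n%:R) @ \oo --> (0 : R) ->
  1 < r -> (0 < n0)%N -> (0 < k)%N ->
  exists m : nat, C * (1 + a (n0 + m * k)%N) ^+ 2 < r ^+ m.
Proof.
move=> a_gt0 a_log r_gt1 n0_gt0 k_gt0.
pose s := ln r.
have s_gt0 : 0 < s by apply: ln_gt0.
have rE : r = expR s by rewrite lnK // posrE; lra.
(* With this [eta], [expR (2 eta n)], which bounds [a_n^2], is up to a constant
   at most the square root of [r ^+ m]; the remaining factor, also the square
   root of [r ^+ m], beats the constants. *)
pose eta := s / (4 * k%:R).
have kR_gt0 : 0 < k%:R :> R by rewrite ltr0n.
have eta_gt0 : 0 < eta by rewrite divr_gt0 // mulr_gt0.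
have [K _ KP] : \forall n \near \oo, `|ln (a n) / n%:R| <= eta.
  by move/cvgr0Pnorm_le : a_log; apply.
have a_le n : (1 <= n)%N -> (K <= n)%N -> a n <= expR (eta * n%:R).
  move=> n1 Kn; rewrite -[a n]lnK ?posrE ?a_gt0 // ler_expR.
  have nR : 0 < n%:R :> R by rewrite ltr0n.
  rewrite -ler_pdivrMr //.
  exact: le_trans (ler_norm _) (KP _ Kn).
pose D := 4 * (`|C| + 1) * expR (2 * eta * n0%:R).
have D_gt0 : 0 < D by rewrite !mulr_gt0 ?expR_gt0 // ltr_pwDr.
pose m := maxn K (Num.truncn (2 * D / s)).+1.
exists m; set n := (n0 + m * k)%N.
have n1 : (1 <= n)%N by rewrite addn_gt0 n0_gt0.
have Kn : (K <= n)%N.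
  apply: leq_trans (leq_maxl K _) _.
  exact: leq_trans (leq_pmulr m k_gt0) (leq_addl _ _).
have an0 := a_gt0 _ n1.
have an := a_le _ n1 Kn.
have e1 : 1 <= expR (eta * n%:R) by rewrite -expR0 ler_expR mulr_ge0 // ltW.
have b1 : (1 + a n) ^+ 2 <= 4 * expR (2 * eta * n%:R).
  have -> : expR (2 * eta * n%:R) = expR (eta * n%:R) ^+ 2.
    by rewrite -expRM_natr; congr expR; ring.
  rewrite (_ : 4 * _ = (2 * expR (eta * n%:R)) ^+ 2); last by ring.
  rewrite ler_pXn2r ?nnegrE //; lra.
have b2 : C * (1 + a n) ^+ 2 <= (`|C| + 1) * (4 * expR (2 * eta * n%:R)).
  have c1 : C * (1 + a n) ^+ 2 <= `|C| * (1 + a n) ^+ 2.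
    by rewrite ler_wpM2r ?sqr_ge0 // ler_norm.
  apply: le_trans c1 _; apply: ler_pM => //; first exact: sqr_ge0.
  lra.
apply: le_lt_trans b2 _.
have -> : (`|C| + 1) * (4 * expR (2 * eta * n%:R)) = D * expR (s / 2 * m%:R).
  rewrite /D /n natrD natrM mulrDr expRD.
  have -> : 2 * eta * (m%:R * k%:R) = s / 2 * m%:R.
    by rewrite /eta; field; rewrite gt_eqF.
  by ring.
have -> : r ^+ m = expR (s / 2 * m%:R) * expR (s / 2 * m%:R).
  by rewrite rE -expRM_natr -expRD; congr expR; field.
rewrite ltr_pM2r ?expR_gt0 //; apply: lt_le_trans (expR_ge1Dx _).
have : 2 * D / s < m%:R.
  apply: lt_le_trans (truncnS_gt _) _.
  by rewrite ler_nat leq_maxr.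
rewrite ltr_pdivrMr //; lra.
Qed.

(** * Hitting a compact set of parameters *)

Lemma gap_iter (R : realType) (a : nat -> R) (n p : nat) :
  (forall n, (1 <= n)%N -> 1 <= a n.+1 - a n) -> (1 <= n)%N ->
  a n + p%:R <= a (n + p)%N.
Proof.
move=> a_gap n1; elim: p => [|p IH]; first by rewrite addr0 addn0.
have := a_gap (n + p)%N (leq_trans n1 (leq_addr _ _)).
by rewrite addnS -(addn1 p) natrD; lra.
Qed.

Lemma truncn_separated (R : realType) (x y : R) :
  0 <= x -> x + 1 <= y -> (Num.truncn x < Num.truncn y)%N.
Proof.
move=> x0 xy; have /andP[x1 x2] := truncn_itv x0.
rewrite truncn_gt_nat; apply: le_trans xy.
by rewrite -addn1 natrD lerD2r.
Qed.

(** Cutting [[j, j + 1[] into [q.+1] cells, [y] is the number of the cell of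
    [x]. *)
Lemma subdivision_cell (R : realType) (q : nat) (x : R) : 0 <= x ->
  let j := Num.truncn x in let y := Num.truncn (q.+1%:R * (x - j%:R)) in
  (y < q.+1)%N /\ j%:R + y%:R / q.+1%:R <= x < j%:R + (y%:R + 1) / q.+1%:R.
Proof.
move=> x0 j y; have /andP[j1 j2] := truncn_itv x0.
have q0 : 0 < q.+1%:R :> R by rewrite ltr0n.
have z0 : 0 <= q.+1%:R * (x - j%:R) by rewrite mulr_ge0 ?subr_ge0.
have /andP[y1 y2] := truncn_itv z0.
split.
  rewrite truncn_lt_nat // -[ltRHS]mulr1 ltr_pM2l //.
  by move: j2; rewrite -addn1 natrD -/j; lra.
rewrite -lerBrDl -ltrBlDl ler_pdivrMr // ltr_pdivlMr // mulrC y1 /=.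
by rewrite natr1.
Qed.

Lemma net_approx (R : realType) (x : R) (L B : nat) : (0 < L)%N ->
  0 <= x <= B%:R -> exists u : 'I_(B * L).+1, u%:R / L%:R <= x <= (u%:R + 1) / L%:R.
Proof.
move=> L0 /andP[x0 xB]; have LR : 0 < L%:R :> R by rewrite ltr0n.
have z0 : 0 <= x * L%:R by rewrite mulr_ge0 // ltW.
have /andP[u1 u2] := truncn_itv z0.
have uB : (Num.truncn (x * L%:R) < (B * L).+1)%N.
  rewrite truncn_lt_nat //; apply: (@le_lt_trans _ _ (B * L)%:R).
    by rewrite natrM ler_pM2r.
  by rewrite ltr_nat.
exists (Ordinal uB) => /=; rewrite ler_pdivrMr // u1 ler_pdivlMr // ltW //=.
by move: u2; rewrite -addn1 natrD.
Qed.

Lemma net_size (R : realType) (k q L : nat) (B : R) :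
  (0 < k)%N -> (0 < q)%N -> (0 < L)%N -> 1 <= B -> L%:R <= q%:R * B + 1 ->
  ((k * L).+1 * (2 * k * L).+1)%N%:R <= 24 * (k ^ 2 * q ^ 2)%N%:R * B ^+ 2.
Proof.
move=> k0 q0 L0 B1 LB.
have q1 : 1 <= q%:R :> R by rewrite ler1n.
have qB : 1 <= q%:R * B by apply: mulr_ege1.
have L2 : L%:R <= 2 * (q%:R * B) by lra.
apply: (@le_trans _ _ (6 * k%:R ^+ 2 * L%:R ^+ 2)).
  rewrite (_ : 6 * _ * _ = (6 * k ^ 2 * L ^ 2)%N%:R); last first.
    by rewrite natrM [(6 * _)%:R]natrM !natrX.
  by rewrite ler_nat; have : (0 < k * L)%N by [rewrite muln_gt0 k0]; nia.
rewrite natrM !natrX.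
have -> : 24 * (k%:R ^+ 2 * q%:R ^+ 2) * B ^+ 2 =
  6 * k%:R ^+ 2 * (2 * (q%:R * B)) ^+ 2 by ring.
rewrite ler_wpM2l ?mulr_ge0 ?sqr_ge0 // ler_pXn2r ?nnegrE ?ler0n //; lra.
Qed.

(** The bound [X] confines the stage to a block, so that different stages can
    use disjoint blocks and the width of the holes can tend to 0. *)
Lemma hit_compact_parameters (R : realType) (a : nat -> R) (k N T : nat) :
  (forall n, (1 <= n)%N -> 0 < a n) ->
  (forall n, (1 <= n)%N -> 1 <= a n.+1 - a n) ->
  (fun n : nat => ln (a n) / n%:R) @ \oo --> (0 : R) ->
  (0 < k)%N ->
  exists (X : nat) (f : nat -> 'I_N.+2), forall c d : R,
    k%:R^-1 <= c <= k%:R -> - k%:R <= d <= k%:R ->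
    exists n j : nat, [/\ (1 <= n)%N, (T <= j < X)%N &
      j%:R + (f j)%:R / N.+2%:R <= c * a n + d
        <= j%:R + (f j)%:R / N.+2%:R + 2 / N.+2%:R].
Proof.
move=> a_gt0 a_gap a_log k_gt0.
have kR0 : 0 < k%:R :> R by rewrite ltr0n.
have q0 : 0 < N.+2%:R :> R by rewrite ltr0n.
(* From the index [n0] on, the images [c * a n + d] lie beyond [T]. *)
pose n0 := (Num.truncn (k%:R * (T%:R + k%:R) : R)).+2.
have a_n0 n : (n0 <= n)%N -> T%:R + k%:R <= k%:R^-1 * a n.
  move=> le_n; rewrite ler_pdivlMl //.
  have := gap_iter (n - 1) a_gap (leqnn 1); have := a_gt0 1%N isT.
  rewrite subnKC; last by apply: leq_trans le_n.
  suff : k%:R * (T%:R + k%:R) <= (n - 1)%:R :> R by lra.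
  apply: le_trans (ltW (truncnS_gt _)) _; rewrite ler_nat.
  by rewrite ltn_subRL add1n.
pose r : R := N.+2%:R / N.+1%:R.
have r_gt1 : 1 < r by rewrite /r ltr_pdivlMr ?ltr0n // mul1r ltr_nat.
have [m mP] := subexponential_lt_geometric (24 * (k ^ 2 * N.+2 ^ 2)%N%:R)
  a_gt0 a_log r_gt1 (ltn0Sn _ : (0 < n0)%N) k_gt0.
set top := a (n0 + m * k)%N in mP.
have top_gt0 : 0 < top by apply: a_gt0.
pose L := (Num.truncn (N.+2%:R * (1 + top))).+1.
have L0 : (0 < L)%N by [].
have LR0 : 0 < L%:R :> R by rewrite ltr0n.
have z0 : 0 <= N.+2%:R * (1 + top) by rewrite mulr_ge0 //; lra.
have /andP[L1 L2] := truncn_itv z0.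
rewrite -/L in L2.
have L3 : L%:R <= N.+2%:R * (1 + top) + 1 by rewrite /L -addn1 natrD lerD2r.
clearbody L.
(* [(u, v)] stands for the net point [(1/k + u/L, v/L - k)]; as this rounds
   down, every net point still has slope at least [1/k]. *)
pose P : finType := ('I_(k * L).+1 * 'I_(2 * k * L).+1)%type.
(* A step of [k] indices makes up for slopes as small as [1/k]: images of
   successive sampled points are at distance at least 1. *)
pose idx (i : 'I_m) := (n0 + i * k)%N.
have idx1 i : (1 <= idx i)%N by [].
have a_idx i : a (idx i) <= top.
  have le_i : (i * k <= m * k)%N by rewrite leq_pmul2r // ltnW.
  have := gap_iter (m * k - i * k) a_gap (idx1 i).
  rewrite /idx -addnA subnKC // -/top.
  by have := ler0n R (m * k - i * k); lra.
pose x (p : P) i : R :=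
  (k%:R^-1 + p.1%:R / L%:R) * a (idx i) + (p.2%:R / L%:R - k%:R).
have x_ge p i : T%:R <= x p i.
  have := a_n0 (idx i) (leq_addr _ _); rewrite /x mulrDl.
  have h1 : 0 <= p.1%:R / L%:R * a (idx i).
    by rewrite mulr_ge0 ?divr_ge0 ?ler0n // ltW // a_gt0.
  have h2 : 0 <= p.2%:R / L%:R :> R by rewrite divr_ge0 ?ler0n.
  lra.
have x_ge0 p i : 0 <= x p i by apply: le_trans (x_ge p i); rewrite ler0n.
have x_sep p (i i' : 'I_m) : (i < i')%N -> x p i + 1 <= x p i'.
  move=> lt_i.
  have H : a (idx i) + k%:R <= a (idx i').
    have -> : idx i' = (idx i + (i' - i) * k)%N.
      by rewrite /idx -addnA -mulnDl subnKC // ltnW.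
    apply: le_trans (gap_iter _ a_gap (idx1 i)); rewrite lerD2l ler_nat.
    by rewrite leq_pmull // subn_gt0.
  have c0 : k%:R^-1 <= k%:R^-1 + p.1%:R / L%:R :> R.
    by rewrite lerDl divr_ge0 ?ler0n.
  have H2 : 1 <= (k%:R^-1 + p.1%:R / L%:R) * (a (idx i') - a (idx i)).
    rewrite -[leLHS](mulVf (lt0r_neq0 kR0)); apply: ler_pM => //; lra.
  by move: H2; rewrite /x mulrBr; lra.
pose J p i := Num.truncn (x p i).
have J_inj p : injective (J p).
  move=> i i' eqJ; apply/val_inj; case: (ltngtP (val i) (val i')) => // lt_i.
  - have := truncn_separated (x_ge0 p i) (x_sep p _ _ lt_i).
    by rewrite -/(J p i) -/(J p i') eqJ ltnn.
  - have := truncn_separated (x_ge0 p i') (x_sep p _ _ lt_i).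
    by rewrite -/(J p i) -/(J p i') eqJ ltnn.
pose y p i : 'I_N.+2 := inord (Num.truncn (N.+2%:R * (x p i - (J p i)%:R))).
have card_P : (#|P| * N.+1 ^ m < N.+2 ^ m)%N.
  rewrite card_prod !card_ord -(ltr_nat R) natrM !natrX -ltr_pdivlMr; last first.
    by rewrite exprn_gt0 // ltr0n.
  rewrite -expr_div_n; apply: le_lt_trans mP.
  by apply: net_size => //; lra.
have [f fP] := exists_transversal y J_inj card_P.
exists (Num.truncn (k%:R * top + k%:R)).+1, f => c d /andP[c1 c2] /andP[d1 d2].
(* Round the parameters down to the net; the image of [a (idx i)] for
   [(c, d)] then exceeds that for [(u, v)] by at most [1 / N.+2]. *)
have [u /andP[u1 u2]] : exists u : 'I_(k * L).+1,
    u%:R / L%:R <= c - k%:R^-1 <= (u%:R + 1) / L%:R.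
  apply: net_approx => //; have : 0 < k%:R^-1 :> R by rewrite invr_gt0.
  by move=> ?; apply/andP; split; lra.
have [v /andP[v1 v2]] : exists v : 'I_(2 * k * L).+1,
    v%:R / L%:R <= d + k%:R <= (v%:R + 1) / L%:R.
  by apply: net_approx => //; rewrite natrM; apply/andP; split; lra.
have [i fi] := fP (u, v).
exists (idx i), (J (u, v) i).
have ai0 := a_gt0 _ (idx1 i); have ai1 := a_idx i.
have err1 : x (u, v) i <= c * a (idx i) + d.
  have : (k%:R^-1 + u%:R / L%:R) * a (idx i) <= c * a (idx i).
    by rewrite ler_pM2r //; lra.
  by rewrite /x /=; lra.
have err2 : c * a (idx i) + d <= x (u, v) i + 1 / N.+2%:R.
  have h1 : c * a (idx i) <= (k%:R^-1 + u%:R / L%:R + 1 / L%:R) * a (idx i).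
    by rewrite ler_pM2r //; move: u2; rewrite mulrDl; lra.
  have h2 : 1 / L%:R * (1 + a (idx i)) <= 1 / N.+2%:R.
    rewrite mul1r ler_pdivrMl // mulrA mulr1 ler_pdivlMr // mulrC.
    apply: le_trans (ltW L2); rewrite ler_pM2l //; lra.
  have h3 : d <= v%:R / L%:R - k%:R + 1 / L%:R by move: v2; rewrite mulrDl; lra.
  rewrite mulrDl in h1; rewrite mulrDr mulr1 in h2; rewrite /x /=.
  apply: le_trans (lerD h1 h3) _.
  by rewrite addrACA lerD2l addrC.
split=> //.
  rewrite /J truncn_ge_nat // x_ge ltnS le_truncn //=.
  apply: le_trans err1 _; apply: lerD => //; apply: ler_pM => //; try lra.
  by apply: le_trans c1; rewrite invr_ge0 ltW.
have [yq] := subdivision_cell N.+1 (x_ge0 (u, v) i).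
rewrite fi /y inordK // -/(J (u, v) i) => /andP[x1 x2].
move: x1 x2 err1 err2; rewrite mulrDl.
by move: (N.+2%:R^-1) => e *; apply/andP; split; lra.
Qed.

(** * Measure of a ray with small holes *)

(** Both measures restrict the same outer measure, to different sigma-algebras;
    the sets below being Borel, the better equipped one can be used. *)
Lemma completed_lebesgue_measureE (R : realType) (A : set R) :
  completed_lebesgue_measure A = lebesgue_measure A.
Proof. by []. Qed.

Lemma lebesgue_measure_itvcc (R : realType) (x y : R) : x <= y ->
  lebesgue_measure [set` `[x, y]] = (y - x)%:E.
Proof.
move=> xy; rewrite lebesgue_measure_itv /= lte_fin.
case: ltP => // yx; have -> : y = x by apply/eqP; rewrite eq_le xy yx.
by rewrite subrr.
Qed.

Definition holes (R : realType) (s w : nat -> R) : set R := \bigcup_j [set` `[s j, s j + w j]].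
Definition punctured_ray (R : realType) (s w : nat -> R) : set R :=
  [set` `[0, +oo[] `\` holes s w.

Lemma measurable_punctured_ray (R : realType) (s w : nat -> R) :
  measurable (punctured_ray s w : set (measurableTypeR R)).
Proof. by apply: measurableD => //; exact: bigcup_measurable. Qed.

(** The hole of index [j] lies in [[j, j + 2]], so only the four indices from
    [Num.truncn t - 2] on can meet [[t, t + 1]]. *)
Lemma unit_window_cover (R : realType) (s w : nat -> R) (t : R) :
  (forall j, j%:R <= s j <= j%:R + 1) -> (forall j, 0 <= w j <= 1) ->
  2 <= t ->
  let q := (Num.truncn t - 2)%N in
  let u j := [set` `[s j, s j + w j]] in
  [set` `[t, t + 1]] `<=` (punctured_ray s w `&` [set` `[t, t + 1]]) `|`
    (u q `|` (u q.+1 `|` (u q.+2 `|` u q.+3))).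
Proof.
move=> s_itv w_itv t2 q u x xt.
have [[j _ xu]|Nx] := pselect (holes s w x); last first.
  left; split=> //; split=> //.
  by move: xt; rewrite /= !in_itv /= => /andP[? ?]; lra.
right.
have /andP[tq1 tq2] := truncn_itv (le_trans (ler0n _ _) t2).
have tr2 : (2 <= Num.truncn t)%N by rewrite truncn_ge_nat //; lra.
have qE : Num.truncn t = q.+2 by rewrite /q; lia.
have [/andP[sj1 sj2] /andP[wj1 wj2]] := (s_itv j, w_itv j).
move: (xu) (xt); rewrite /= !in_itv /= => /andP[xu1 xu2] /andP[xt1 xt2].
rewrite qE in tq1 tq2.
have jq : (q <= j)%N.
  rewrite -(leq_add2r 2) -(ler_nat R) !natrD.
  by move: tq1; rewrite -addn2 natrD; lra.
have jq4 : (j < q + 4)%N.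
  by rewrite -(ltr_nat R) natrD; move: tq2; rewrite -addn3 natrD; lra.
have [->|jq0] := eqVneq q j; first by left.
have [->|jq1] := eqVneq q.+1 j; first by right; left.
have [->|jq2] := eqVneq q.+2 j; first by right; right; left.
by have -> : q.+3 = j by [lia]; right; right; right.
Qed.

(** Each unit window loses at most the four widths of [unit_window_cover]. *)
Lemma cvg_measure_punctured_ray (R : realType) (s w : nat -> R) :
  (forall j, j%:R <= s j <= j%:R + 1) -> (forall j, 0 <= w j <= 1) ->
  w @ \oo --> (0 : R) ->
  (fun t : R => completed_lebesgue_measure (punctured_ray s w `&` [set` `[t, t + 1]]))
    @ +oo --> 1%E.
Proof.
move=> s_itv w_itv w0.
under eq_fun do rewrite completed_lebesgue_measureE.
pose mu := @lebesgue_measure R.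
have muI (x y : R) : x <= y -> mu [set` `[x, y]] = (y - x)%:E.
  exact: lebesgue_measure_itvcc.
have mE t : measurable (punctured_ray s w `&` [set` `[t, t + 1]] : set (measurableTypeR R)).
  by apply: measurableI => //; exact: measurable_punctured_ray.
have mu_le (A B : set (measurableTypeR R)) :
    measurable A -> measurable B -> A `<=` B -> (mu A <= mu B)%E.
  by move=> mA mB; apply: le_measure; rewrite inE.
have mu_w j : mu [set` `[s j, s j + w j]] = (w j)%:E.
  rewrite muI; first by congr EFin; lra.
  by case/andP: (w_itv j) => ? ?; lra.
have mu1 (t : R) : mu [set` `[t, t + 1]] = 1%E.
  by rewrite muI; [congr EFin|]; lra.
have le1 (t : R) : (mu (punctured_ray s w `&` [set` `[t, t + 1]%R]) <= 1)%E.
  by rewrite -(mu1 t); apply: mu_le => // x [].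
have fin (t : R) : mu (punctured_ray s w `&` [set` `[t, t + 1]]) \is a fin_num.
  rewrite ge0_fin_numE ?measure_ge0 //.
  exact: le_lt_trans (le1 t) (ltry _).
apply/fine_cvgP; split; first by apply: nearW => t; exact: fin.
apply/cvgrPdist_le => e e0.
have [K _ KP] : \forall j \near \oo, `|w j| <= e / 4.
  by move/cvgr0Pnorm_le : w0; apply; rewrite divr_gt0.
have w_le j : (K <= j)%N -> w j <= e / 4.
  by move=> /KP; exact: le_trans (ler_norm _).
near=> t.
have tK : K.+3%:R <= t by near: t; apply: nbhs_pinfty_ge; rewrite num_real.
have t2 : 2 <= t by apply: le_trans tK; rewrite ler_nat.
set x := (fine \o _) t.
have xE : mu (punctured_ray s w `&` [set` `[t, t + 1]]) = x%:E by rewrite fineK.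
have x1 : x <= 1 by rewrite -lee_fin -xE.
set q := (Num.truncn t - 2)%N.
have Kq : (K <= q)%N.
  have : (K.+3 <= Num.truncn t)%N by rewrite truncn_ge_nat //; lra.
  by rewrite /q; lia.
have : (1%:E <= x%:E + ((w q)%:E + ((w q.+1)%:E + ((w q.+2)%:E + (w q.+3)%:E))))%E.
  rewrite -(mu1 t).
  apply: le_trans (mu_le _ _ _ _ (unit_window_cover s_itv w_itv t2)) _ => //.
    by repeat apply: measurableU => //.
  rewrite -xE -!mu_w.
  by do 4 (apply: le_trans (measureU2 _ _ _) _;
    try (by repeat (apply: measurableU => //)); apply: leeD => //).
rewrite -!EFinD lee_fin => H.
have := w_le _ Kq.
have := w_le _ (leqW Kq).
have := w_le _ (leqW (leqW Kq)).
have := w_le _ (leqW (leqW (leqW Kq))).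
rewrite ler_norml => *; apply/andP; split; lra.
Unshelve. all: by end_near.
Qed.

(** * Hitting all parameters *)

(** The blocks [[T k, T k.+1[] are disjoint and go to infinity, so a place
    determines the stage to which it belongs. *)
Lemma block_index (T : nat -> nat) : (forall k, (T k < T k.+1)%N) ->
  exists kappa : nat -> nat,
    (forall k j, (T k <= j < T k.+1)%N -> kappa j = k) /\
    (forall k j, (T k <= j)%N -> (k <= kappa j)%N).
Proof.
move=> T_incr.
have T_mono : {homo T : i j / (i <= j)%N} 
  by apply: (homo_leq leqnn) => [? ? ?|i]; [exact: leq_trans|exact: ltnW].
have T_ge k : (k <= T k)%N.
  by elim: k => // k IH; exact: leq_ltn_trans IH (T_incr k).
have ex_k j : exists k, (j < T k.+1)%N by exists j; exact: T_ge.
have lower k j : (T k <= j)%N -> (k <= ex_minn (ex_k j))%N.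
  move=> Tkj; case: ex_minnP => i ij _; rewrite leqNgt; apply/negP => ik.
  by have := leq_trans ij (leq_trans (T_mono _ _ ik) Tkj); rewrite ltnn.
exists (fun j => ex_minn (ex_k j)); split=> // k j /andP[kj jk].
apply/eqP; rewrite eqn_leq lower // andbT.
by case: ex_minnP => i _; exact.
Qed.

Lemma hit_all_parameters (R : realType) (a : nat -> R) :
  (forall n, (1 <= n)%N -> 0 < a n) ->
  (forall n, (1 <= n)%N -> 1 <= a n.+1 - a n) ->
  (fun n : nat => ln (a n) / n%:R) @ \oo --> (0 : R) ->
  exists s w : nat -> R,
    [/\ forall j, j%:R <= s j <= j%:R + 1, forall j, 0 <= w j <= 1,
        w @ \oo --> (0 : R)
      & forall c d : R, 0 < c ->
        exists2 n, (1 <= n)%N & holes s w (c * a n + d)].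
Proof.
move=> a_gt0 a_gap a_log.
have stage (kT : nat * nat) : exists Xf : nat * (nat -> R),
    (forall j, 0 <= Xf.2 j <= 1) /\
    forall c d : R, kT.1.+1%:R^-1 <= c <= kT.1.+1%:R ->
    - kT.1.+1%:R <= d <= kT.1.+1%:R ->
    exists n j : nat, [/\ (1 <= n)%N, (kT.2 <= j < Xf.1)%N &
      j%:R + Xf.2 j <= c * a n + d <= j%:R + Xf.2 j + 2 / kT.1.+2%:R].
  have [X [f fP]] :=
    hit_compact_parameters kT.1 kT.2 a_gt0 a_gap a_log (ltn0Sn kT.1).
  exists (X, fun j => (f j)%:R / kT.1.+2%:R); split=> // j /=.
  by rewrite divr_ge0 ?ler0n //= ler_pdivrMr ?ltr0n // mul1r ler_nat ltnW.
have [F FP] := choice stage.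
(* The maximum keeps [T] strictly increasing even when a block is empty. *)
pose T := fix T k := if k is k'.+1 then maxn (T k').+1 (F (k', T k')).1 else 0%N.
have T_incr k : (T k < T k.+1)%N by exact: leq_maxl.
have [kappa [kappaE kappa_ge]] := block_index T_incr.
exists (fun j => j%:R + (F (kappa j, T (kappa j))).2 j).
exists (fun j => 2 / (kappa j).+2%:R).
split.
- by move=> j; have [/(_ j) /andP[? ?] _] := FP (kappa j, T (kappa j)); lra.
- move=> j; rewrite divr_ge0 ?ler0n //= ler_pdivrMr ?ltr0n // mul1r ler_nat //.
- apply/cvgr0Pnorm_le => e e0.
  exists (T (Num.truncn (2 / e))) => // j /= /kappa_ge le_k.
  rewrite ger0_norm ?divr_ge0 ?ler0n // ler_pdivrMr ?ltr0n // mulrC -ler_pdivrMr //.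
  apply: le_trans (ltW (truncnS_gt _)) _.
  by rewrite ler_nat ltnS leqW.
- move=> c d c0.
  pose k := (Num.truncn c + Num.truncn c^-1 + Num.truncn `|d|)%N.
  have trunc_le (x : R) : (Num.truncn x <= k)%N -> x <= k.+1%:R.
    by move=> le_x; apply: le_trans (ltW (truncnS_gt _)) _; rewrite ler_nat.
  have c_le : c <= k.+1%:R by apply: trunc_le; rewrite /k -addnA leq_addr.
  have c_ge : k.+1%:R^-1 <= c.
    rewrite -[c]invrK lef_pV2 ?posrE ?invr_gt0 ?ltr0n //.
    by apply: trunc_le; rewrite /k addnAC leq_addl.
  have : `|d| <= k.+1%:R by apply: trunc_le; rewrite /k leq_addl.
  rewrite ler_norml => d_le.
  have cP : k.+1%:R^-1 <= c <= k.+1%:R by rewrite c_ge.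
  have [_ /(_ c d cP d_le)[n [j [n1 /andP[Tj jF] hit]]]] := FP (k, T k).
  exists n => //; exists j => //.
  have kE : kappa j = k.
    by apply: kappaE; rewrite Tj; exact: leq_trans jF (leq_maxr _ _).
  by rewrite /= in_itv /= kE.
Qed.

(** * Avoiding similar copies *)

Theorem theorem2p4 (R : realType) (a : nat -> R) (A : set R)
  (A_def : A = [set a n | n in [set n : nat | (1 <= n)%N]])
  (A_pos : A `<=` [set x | 0 < x])
  (a_gap : forall n : nat, (1 <= n)%N -> 1 <= a n.+1 - a n)
  (a_log : (fun n : nat => ln (a n) / n%:R) @ \oo --> (0 : R)) :
  exists E : set R,
    [/\ lebesgue_measurable E,
        (fun t : R => completed_lebesgue_measure (E `&` [set` `[t, t + 1]]))
          @ +oo --> 1%E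
      & ~ (exists2 T : set R, similar_copy A T & T `<=` E)].
Proof.
have aA n : (1 <= n)%N -> A (a n) by move=> n1; rewrite A_def; exists n.
have a_gt0 n : (1 <= n)%N -> 0 < a n by move=> /aA /A_pos.
have [s [w [s_itv w_itv w0 hit]]] := hit_all_parameters a_gt0 a_gap a_log.
exists (punctured_ray s w); split.
- apply: sub_caratheodory; exact: measurable_punctured_ray.
- exact: cvg_measure_punctured_ray.
move=> [_ [c [d [c_neq0 ->]]] sub].
have in_ray n : (1 <= n)%N -> punctured_ray s w (c * a n + d).
  by move=> n1; apply: sub; exists (a n) => //; exact: aA.
have [c_lt0|c_gt0|c0] := ltgtP c 0; last by rewrite c0 eqxx in c_neq0.
(* For [c < 0] some image is negative, hence off the ray. *)
- pose p := (Num.truncn (`|d| / - c)).+1.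
  have p_gt : `|d| / - c < p%:R := truncnS_gt _.
  rewrite ltr_pdivrMr ?oppr_gt0 // in p_gt.
  have a_ge : p%:R <= a (1 + p)%N.
    by have := gap_iter p a_gap (leqnn 1); have := a_gt0 1%N isT; lra.
  have [] := in_ray (1 + p)%N isT.
  rewrite /= in_itv /= andbT => ray _.
  have : a (1 + p)%N * c <= p%:R * c by rewrite ler_nM2r.
  have := ler_norm d; lra.
- by have [n n1] := hit c d c_gt0; have [] := in_ray n n1.
Qed.
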